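(* Let $f:\mathbb{R}^d\to\mathbb{R}$ be convex and differentiable with Lipschitz continuous gradient (constant $L$), let $g:\mathbb{R}^d\to\mathbb{R}\cup\{+\infty\}$ and $h:\mathbb{R}^{d'}\to\mathbb{R}\cup\{+\infty\}$ be proper, convex and closed, let $A:\mathbb{R}^d\to\mathbb{R}^{d'}$ be linear and $\lambda,\mu>0$. Assume that $\partial(\lambda g+\mu\, h\circ A)(u)=\lambda\,\partial g(u)+\mu A^T\partial h(Au)$ for all $u$, and that $f+\lambda g+\mu\, h\circ A$ has a minimizer (with finite value). Let $\alpha,\beta>0$ satisfy $\beta\|A\|^2<1/\alpha-L/2$, and let $(\lambda_n)_{n\in\mathbb{N}},(\mu_n)_{n\in\mathbb{N}}$ be strictly positive sequences with $\sum_n|\lambda_n-\lambda|<\infty$ and $\sum_n|\mu_n-\mu|<\infty$. Assume moreover that $g$ is continuous on its domain, and that $h^*$ has a bounded and closed domain and is continuous on it. Let $(u_0,v_0)\in\mathbb{R}^d\times\mathbb{R}^{d'}$ and, for $n\ge0$, $$u_{n+1}=\operatorname{prox}_{\alpha\lambda_n g}\bigl(u_n-\alpha\nabla f(u_n)-\alpha\mu_nA^Tv_n\bigr),\qquad v_{n+1}=\operatorname{prox}_{(\beta/\mu_n)h^*}\bigl(v_n+(\beta/\mu_n)A(2u_{n+1}-u_n)\bigr).$$ Put $u^{(n)}_{\lambda,\mu_n}=\operatorname{prox}_{\alpha\lambda g}(u_n-\alpha\nabla f(u_n)-\alpha\mu_nA^Tv_n)$ and $$M_1=\sup_{n\in\mathbb{N}}\bigl|g(u_{n+1})-g(u^{(n)}_{\lambda,\mu_n})\bigr|,$$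 $$M_2=\sup\bigl\{|h^*(v_{n+1})-h^*(v)|+\|A\|\,\|2u_{n+1}-u_n\|_2\,\|v-v_{n+1}\|_2:\ n\in\mathbb{N},\ v\in\operatorname{dom}(h^* )\bigr\}.$$ Then $M_1<\infty$, $M_2<\infty$, and for every $n\ge 0$, with $e_{n+1}=(\mu_n-\mu)A^Tv_n$, $\epsilon_{n+1}=\alpha M_1|\lambda_n-\lambda|$ and $\delta_{n+1}=\beta M_2|\mu_n^{-1}-\mu^{-1}|$, one has $$u_{n+1}\approx_1^{\epsilon_{n+1}}\operatorname{prox}_{\alpha\lambda g}\bigl(u_n-\alpha\nabla f(u_n)-\alpha\mu A^Tv_n-\alpha e_{n+1}\bigr),$$ $$v_{n+1}\approx_2^{\delta_{n+1}}\operatorname{prox}_{(\beta/\mu)h^*}\bigl(v_n+(\beta/\mu)A(2u_{n+1}-u_n)\bigr).$$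
   Context: For a proper convex closed $F$ on $\mathbb{R}^m$: $\operatorname{prox}_F(a)=\arg\min_{u}\frac12\|u-a\|_2^2+F(u)$; $\operatorname{dom}(F)=\{u: F(u)<+\infty\}$; $F^*(\xi)=\sup_u\langle\xi,u\rangle-F(u)$; $\partial$ is the convex subdifferential; $\|A\|$ is the spectral norm. For $\epsilon\ge0$ and $u\in\operatorname{dom}(F)$, the $\epsilon$-subdifferential is $\partial_\epsilon F(u)=\{\xi:\ F(w)\ge F(u)+\langle\xi,w-u\rangle-\epsilon\ \ \forall w\in\operatorname{dom}(F)\}$. Write $\varphi^{(a)}(u)=\frac12\|u-a\|_2^2+F(u)$. A point $\tilde u$ is an $\epsilon$-approximation of type 1 of $\operatorname{prox}_F(a)$, written $\tilde u\approx_1^\epsilon\operatorname{prox}_F(a)$, if $0\in\partial_\epsilon\varphi^{(a)}(\tilde u)$. It is an $\epsilon$-approximation of type 2, written $\tilde u\approx_2^\epsilon\operatorname{prox}_F(a)$, if $a-\tilde u\in\partial_\epsilon F(\tilde u)$. *)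

(* Defs.v *)
From mathcomp Require Export all_boot all_order all_algebra.
From mathcomp Require Export all_classical all_reals all_analysis.

Set Implicit Arguments.
Unset Strict Implicit.
Unset Printing Implicit Defensive.

Export Order.TTheory GRing.Theory Num.Theory.
Export numFieldNormedType.Exports.

Local Open Scope classical_set_scope.
Local Open Scope ring_scope.

(* Vectors of R^m are columns 'cV[R]_m.  The library norm `|x| on 'cV[R]_m is
   the sup norm, so the Euclidean structure is introduced here; topological
   notions (closed, bounded, continuous, differentiable) do not depend on this
   choice and are those of the library. *)

Definition dotv {R : realType} {m : nat} (x y : 'cV[R]_m) : R :=
  \sum_(i < m) x i 0 * y i 0.

Definition norm2 {R : realType} {m : nat} (x : 'cV[R]_m) : R :=
  Num.sqrt (dotv x x).

Definition spectral_norm {R : realType} {m n : nat} (A : 'M[R]_(m, n)) : R :=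
  sup [set norm2 (A *m x) | x in [set x : 'cV[R]_n | norm2 x <= 1]].

Definition grad {R : realType} {m : nat} (f : 'cV[R]_m -> R) (x : 'cV[R]_m) :
  'cV[R]_m := \col_(i < m) 'D_(delta_mx i 0) f x.

Definition edom {R : realType} {m : nat} (F : 'cV[R]_m -> \bar R) :
  set 'cV[R]_m := [set u | (F u < +oo)%E].

Definition proper_fun {R : realType} {m : nat} (F : 'cV[R]_m -> \bar R) : Prop :=
  (forall u, (-oo < F u)%E) /\ edom F !=set0.

(* Meant for functions that never take the value -oo; recall 0 * +oo = 0. *)
Definition econvex {R : realType} {m : nat} (F : 'cV[R]_m -> \bar R) : Prop :=
  forall (t : R) (x y : 'cV[R]_m), 0 <= t <= 1 ->
    (F (t *: x + (1 - t) *: y)%R <= t%:E * F x + (1 - t)%:E * F y)%E.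

(* Closed in the sense of convex analysis: the epigraph is closed. *)
Definition closed_fun {R : realType} {m : nat} (F : 'cV[R]_m -> \bar R) : Prop :=
  closed [set p : 'cV[R]_m * R | (F p.1 <= p.2%:E)%E].

Definition proper_convex_closed {R : realType} {m : nat}
  (F : 'cV[R]_m -> \bar R) : Prop :=
  [/\ proper_fun F, econvex F & closed_fun F].

Definition escale {R : realType} {m : nat} (c : R) (F : 'cV[R]_m -> \bar R) :
  'cV[R]_m -> \bar R := fun u => (c%:E * F u)%E.

Definition conjugate {R : realType} {m : nat} (F : 'cV[R]_m -> \bar R) :
  'cV[R]_m -> \bar R :=
  fun xi => ereal_sup (range (fun u => ((dotv xi u)%:E - F u)%E)).

(* For proper F this is empty outside of the domain of F. *)
Definition subdiff {R : realType} {m : nat} (F : 'cV[R]_m -> \bar R)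
  (u : 'cV[R]_m) : set 'cV[R]_m :=
  [set xi | forall w, (F u + (dotv xi (w - u)%R)%:E <= F w)%E].

(* The side conditions 0 <= eps and u in dom F, under which the
   eps-subdifferential is considered, are part of membership. *)
Definition eps_subdiff {R : realType} {m : nat} (eps : R)
  (F : 'cV[R]_m -> \bar R) (u : 'cV[R]_m) : set 'cV[R]_m :=
  [set xi | [/\ 0 <= eps, edom F u &
     forall w, edom F w ->
       (F u + (dotv xi (w - u)%R)%:E - eps%:E <= F w)%E]].

Definition prox_obj {R : realType} {m : nat} (F : 'cV[R]_m -> \bar R)
  (a : 'cV[R]_m) : 'cV[R]_m -> \bar R :=
  fun u => ((norm2 (u - a)%R ^+ 2 / 2)%:E + F u)%E.

(* The minimizer exists and is unique when F is proper, convex and closed; the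
   default value 0 is only relevant for other F. *)
Definition prox {R : realType} {m : nat} (F : 'cV[R]_m -> \bar R)
  (a : 'cV[R]_m) : 'cV[R]_m :=
  xget 0 [set u | forall w, (prox_obj F a u <= prox_obj F a w)%E].

Definition prox_approx1 {R : realType} {m : nat} (eps : R)
  (F : 'cV[R]_m -> \bar R) (a u : 'cV[R]_m) : Prop :=
  eps_subdiff eps (prox_obj F a) u 0.

Definition prox_approx2 {R : realType} {m : nat} (eps : R)
  (F : 'cV[R]_m -> \bar R) (a u : 'cV[R]_m) : Prop :=
  eps_subdiff eps F u (a - u).

(* Main.v *)
Require Import Defs.
From mathcomp Require Import ring lra.

Local Open Scope classical_set_scope.
Local Open Scope ring_scope.

(** The two approximation claims are comparisons of minimality properties. The
    points [u n.+1] and [ubar n] minimise the objectives with parameters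
    [alpha * lam_ n] and [alpha * lambda] at the same centre, because the
    perturbation [alpha *: e] turns [mu] into [mu_ n]; adding the two
    minimality inequalities, [u n.+1] misses the second minimum by at most
    [alpha * `|lam_ n - lambda|] times the gap of the values of [g], which is
    at most [M1] ([prox_rescaled_approx1]). For the dual variable the centre
    depends on the parameter as well, so the optimality inclusions are
    compared instead ([prox_rescaled_approx2]).

    The substance is the finiteness of [M1] and [M2], which rests on the
    boundedness of the iterates. The dual iterates live in the bounded domain
    of [h^*]. For the primal ones, Fermat's rule and the subdifferential sum
    rule turn the minimiser into a saddle point [(x, y)] with subgradients
    [xi] of [g] at [x] and [A *m x] of [h^*] at [y] ([fermat_rule],
    [conjugate_subdiff]). Monotonicity of the subdifferentials, cocoercivity of
    the gradient ([gradient_three_points]) and the step size condition show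
    that the energy
    [|U|^2 / alpha - 2 <A U, W> + |W|^2 / beta] of [U = u n - x] and
    [W = mu_ n (v n - y)] increases in one step by at most a summable sequence
    times [1 + |u n.+1 - x|] ([iterates_energy_step], [pd_energy_rescale]).
    With this choice of [W] the error terms involve only the fixed vectors [xi]
    and [A^T *m y] and the bounded dual sequence. Since the energy dominates a
    positive multiple of [|U|^2], the primal iterates are bounded
    ([quasi_fejer_bounded], [iterates_bounded]).

    Values of [g] at proximal points with bounded centres are then bounded:
    from below by the subgradient [xi], from above by the optimality inclusion
    tested at [x], as [1 / lam_ n] is bounded ([prox_value_bound],
    [positive_summable_inv_bounded]). On the compact domain of [h^*] the
    continuous function [h^*] is bounded, which gives [M2]. *)

(** * Euclidean norm and spectral norm *)

Section EuclideanSpace.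
Set Implicit Arguments.
Unset Strict Implicit.
Context {R : realType}.
Implicit Types (m n : nat).

Lemma dotvC m (x y : 'cV[R]_m) : dotv x y = dotv y x.
Proof. by apply: eq_bigr => i _; rewrite mulrC. Qed.

Lemma dotvDl m (x y z : 'cV[R]_m) : dotv (x + y) z = dotv x z + dotv y z.
Proof. by rewrite -big_split; apply: eq_bigr => i _; rewrite mxE mulrDl. Qed.

Lemma dotvZl m c (x y : 'cV[R]_m) : dotv (c *: x) y = c * dotv x y.
Proof. by rewrite mulr_sumr; apply: eq_bigr => i _; rewrite mxE mulrA. Qed.

Lemma dotvNl m (x y : 'cV[R]_m) : dotv (- x) y = - dotv x y.
Proof. by rewrite -scaleN1r dotvZl mulN1r. Qed.

Lemma dotvDr m (x y z : 'cV[R]_m) : dotv x (y + z) = dotv x y + dotv x z.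
Proof. by rewrite dotvC dotvDl !(dotvC x). Qed.

Lemma dotvZr m c (x y : 'cV[R]_m) : dotv x (c *: y) = c * dotv x y.
Proof. by rewrite dotvC dotvZl (dotvC x). Qed.

Lemma dotvNr m (x y : 'cV[R]_m) : dotv x (- y) = - dotv x y.
Proof. by rewrite dotvC dotvNl (dotvC x). Qed.

Lemma dotv0l m (x : 'cV[R]_m) : dotv 0 x = 0.
Proof. by rewrite -(scale0r x) dotvZl mul0r. Qed.

Definition dotvE :=
  (@dotvDl, @dotvDr, @dotvZl, @dotvZr, @dotvNl, @dotvNr).

Lemma dotv_mulmx m n (B : 'M[R]_(m, n)) x y :
  dotv (B *m x) y = dotv x (B^T *m y).
Proof.
rewrite /dotv.
under eq_bigr do rewrite mxE mulr_suml.
rewrite exchange_big; apply: eq_bigr => j _.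
rewrite mxE mulr_sumr; apply: eq_bigr => i _.
by rewrite mxE mulrCA mulrA.
Qed.

Lemma dotv_ge0 m (x : 'cV[R]_m) : 0 <= dotv x x.
Proof. by apply: sumr_ge0 => i _; rewrite -expr2 sqr_ge0. Qed.

Lemma norm2_ge0 m (x : 'cV[R]_m) : 0 <= norm2 x.
Proof. exact: sqrtr_ge0. Qed.

Lemma norm2_sqr m (x : 'cV[R]_m) : norm2 x ^+ 2 = dotv x x.
Proof. by rewrite sqr_sqrtr ?dotv_ge0. Qed.

Lemma norm2_le m (x : 'cV[R]_m) c : 0 <= c -> (norm2 x <= c) = (dotv x x <= c ^+ 2).
Proof. by move=> c0; rewrite -norm2_sqr ler_sqr ?nnegrE ?norm2_ge0. Qed.

(** The discriminant of the nonnegative quadratic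
    [t |-> dotv (x - t y) (x - t y)] is nonpositive. *)
Lemma dotv_cauchy_schwarz m (x y : 'cV[R]_m) :
  `|dotv x y| <= norm2 x * norm2 y.
Proof.
have nn : 0 <= norm2 x * norm2 y by rewrite mulr_ge0 ?norm2_ge0.
rewrite -ler_sqr ?nnegrE // real_normK ?num_real // exprMn !norm2_sqr.
have := dotv_ge0 (dotv y y *: x - dotv x y *: y).
rewrite !dotvE (dotvC y x) => D.
have [/eqP y0|ypos] := boolP (dotv y y == 0).
  have H0 : forall i, y i 0 = 0.
    move=> i; apply/eqP; rewrite -sqrf_eq0 expr2; apply/eqP.
    move/eqP: y0; rewrite psumr_eq0 => [/allP/(_ i)|j _].
      by rewrite mem_index_enum => /(_ isT)/eqP.
    by rewrite -expr2 sqr_ge0.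
  rewrite y0 mulr0 (_ : dotv x y = 0) ?expr0n//.
  by rewrite /dotv big1 // => i _; rewrite H0 mulr0.
have yp : 0 < dotv y y by rewrite lt_def ypos dotv_ge0.
rewrite -subr_ge0 -(pmulr_rge0 _ yp); apply: le_trans D _.
by rewrite le_eqVlt; apply/orP; left; apply/eqP; ring.
Qed.

Lemma dotv_le m (x y : 'cV[R]_m) : dotv x y <= norm2 x * norm2 y.
Proof. exact: le_trans (ler_norm _) (dotv_cauchy_schwarz x y). Qed.

Lemma norm2D m (x y : 'cV[R]_m) : norm2 (x + y) <= norm2 x + norm2 y.
Proof.
rewrite norm2_le ?addr_ge0 ?norm2_ge0 //.
rewrite sqrrD !norm2_sqr !dotvE (dotvC y x).
by have := dotv_le x y; lra.
Qed.

Lemma norm2Z m c (x : 'cV[R]_m) : norm2 (c *: x) = `|c| * norm2 x.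
Proof.
by rewrite /norm2 dotvZl dotvZr mulrA -expr2 sqrtrM ?sqr_ge0// sqrtr_sqr.
Qed.

Lemma norm2N m (x : 'cV[R]_m) : norm2 (- x) = norm2 x.
Proof. by rewrite -scaleN1r norm2Z normrN1 mul1r. Qed.

Lemma norm2B m (x y : 'cV[R]_m) : norm2 (x - y) <= norm2 x + norm2 y.
Proof. by rewrite -(norm2N y) norm2D. Qed.

Lemma norm2_dist m (x y : 'cV[R]_m) : norm2 x <= norm2 (x - y) + norm2 y.
Proof. by rewrite -{1}(subrK y x) norm2D. Qed.

Lemma norm2_0 m : norm2 (0 : 'cV[R]_m) = 0.
Proof. by rewrite /norm2 dotv0l sqrtr0. Qed.

Lemma coord_le_norm2 m (x : 'cV[R]_m) i : `|x i 0| <= norm2 x.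
Proof.
rewrite -ler_sqr ?nnegrE ?norm2_ge0 // norm2_sqr real_normK ?num_real //.
rewrite /dotv (bigD1 i) //= -expr2 lerDl.
by apply: sumr_ge0 => j _; rewrite -expr2 sqr_ge0.
Qed.

Lemma norm2_le_coord m (x : 'cV[R]_m) c :
  (forall i, `|x i 0| <= c) -> norm2 x <= m%:R * `|c|.
Proof.
move=> xc; rewrite norm2_le ?mulr_ge0 //.
case: m x xc => [|m] x xc; first by rewrite /dotv big_ord0 sqr_ge0.
apply: (@le_trans _ _ (\sum_(i < m.+1) `|c| ^+ 2)).
  apply: ler_sum => i _; rewrite -expr2 -(real_normK (num_real (x i 0))).
  by rewrite ler_sqr ?nnegrE //; exact: le_trans (xc i) (ler_norm _).
rewrite sumr_const card_ord -[leLHS]mulr_natl exprMn ler_wpM2r ?sqr_ge0 //.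
by rewrite expr2 ler_peMl // ler1n.
Qed.

(** Boundedness of the set that defines the spectral norm comes from
    comparing each coordinate of [B x] with a row of [B]. *)
Lemma spectral_norm_has_sup m n (B : 'M[R]_(m, n)) :
  has_sup [set norm2 (B *m x) | x in [set x : 'cV[R]_n | norm2 x <= 1]].
Proof.
split; first by exists (norm2 (B *m (0 : 'cV_n))), 0 => //=; rewrite norm2_0.
exists (m%:R * `|\sum_i norm2 (row i B)^T|) => _ [x /= x1 <-].
apply: norm2_le_coord => i.
have -> : (B *m x) i 0 = dotv (row i B)^T x.
  by rewrite mxE; apply: eq_bigr => j _; rewrite !mxE.
apply: le_trans (dotv_cauchy_schwarz _ _) _.
rewrite (bigD1 i) //=; apply: (@le_trans _ _ (norm2 (row i B)^T)).
  by rewrite ler_piMr ?norm2_ge0.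
by rewrite lerDl sumr_ge0 // => j _; exact: norm2_ge0.
Qed.

Lemma spectral_norm_ge0 m n (B : 'M[R]_(m, n)) : 0 <= spectral_norm B.
Proof.
apply: (@le_trans _ _ (norm2 (B *m (0 : 'cV_n)))); first exact: norm2_ge0.
apply: ub_le_sup; first by have [] := spectral_norm_has_sup B.
by exists 0 => //=; rewrite norm2_0.
Qed.

Lemma norm2_mulmx m n (B : 'M[R]_(m, n)) (x : 'cV[R]_n) :
  norm2 (B *m x) <= spectral_norm B * norm2 x.
Proof.
have [x0|xn0] := eqVneq (norm2 x) 0.
  rewrite x0 mulr0; have {}x0 : x = 0.
    apply/matrixP => i j; rewrite ord1 mxE; apply/eqP.
    by rewrite -normr_le0 -x0 coord_le_norm2.
  by rewrite x0 mulmx0 norm2_0.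
have xp : 0 < norm2 x by rewrite lt_def xn0 norm2_ge0.
rewrite -ler_pdivrMr //.
have -> : norm2 (B *m x) / norm2 x = norm2 (B *m ((norm2 x)^-1 *: x)).
  by rewrite -scalemxAr norm2Z ger0_norm ?invr_ge0 ?norm2_ge0 // mulrC.
apply: ub_le_sup; first by have [] := spectral_norm_has_sup B.
exists ((norm2 x)^-1 *: x) => //=.
by rewrite norm2Z ger0_norm ?invr_ge0 ?norm2_ge0 // mulVf.
Qed.

End EuclideanSpace.

(** * Convex functions with Lipschitz gradient *)

(** First-order comparison along a segment without derivatives: the convexity
    inequalities below are divided by [t] and tested for small [t]. *)
Lemma le0_of_le_small (R : realFieldType) (a b : R) :
  (forall t, 0 < t <= 1 -> a <= t * b) -> a <= 0.
Proof.
move=> ab; rewrite leNgt; apply/negP => a0.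
have ba : a <= b by have := ab 1; rewrite ltr01 lexx mul1r; exact.
have b0 : 0 < b := lt_le_trans a0 ba.
have := ab (a / (b * 2)); rewrite divr_gt0 ?mulr_gt0 //.
have -> : a / (b * 2) * b = a / 2 by field; rewrite gt_eqF.
by rewrite ler_pdivrMr ?mulr_gt0 // mul1r => /(_ _); lra.
Qed.

Section SmoothFunctions.
Set Implicit Arguments.
Unset Strict Implicit.
Context {R : realType} {d : nat}.
Variables (f : 'cV[R]_d -> R) (K : R).
Hypothesis f_diff : forall x, differentiable f x.
Hypothesis f_lip : forall x y, norm2 (grad f x - grad f y) <= K * norm2 (x - y).

Lemma derive_grad x w : 'D_w f x = dotv (grad f x) w.
Proof.
rewrite deriveE // {1}(matrix_sum_delta w) linear_sum; apply: eq_bigr => i _.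
by rewrite big_ord1 linearZ /= -deriveE // mxE mulrC.
Qed.

(** The directional derivative commutes with restriction to a line because the
    difference quotients are literally the same. *)
Lemma is_derive_line x w (t : R) :
  is_derive t 1 (fun s : R => f (s *: w + x)) (dotv (grad f (t *: w + x)) w).
Proof.
have E : (fun h : R => h^-1 *: (((fun s : R => f (s *: w + x)) \o shift t) (h *: 1)
    - f (t *: w + x))) =
    (fun h : R => h^-1 *: ((f \o shift (t *: w + x)) (h *: w) - f (t *: w + x))).
  by apply/funext => h /=; rewrite /shift /= [h *: 1]mulr1 scalerDl addrA.
apply: DeriveDef; first by rewrite /derivable E; exact: diff_derivable.
by rewrite /derive E -derive_grad.
Qed.

(** Along the segment from [x] to [w + x], the function
    [f (x + t w) - t dotv (grad f x) w - K / 2 t^2 |w|^2] of [t] has a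
    nonpositive derivative. *)
Lemma descent_lemma x w :
  f (w + x) <= f x + dotv (grad f x) w + K / 2 * norm2 w ^+ 2.
Proof.
set p := dotv (grad f x) w; set k := K / 2 * norm2 w ^+ 2.
pose phi : R -> R := (fun s : R => f (s *: w + x)) - (p *: id + k *: (id * id)).
pose dphi := fun t : R => dotv (grad f (t *: w + x)) w - (p + k * (t + t)).
have dphiP (t : R) : is_derive t 1 phi (dphi t).
  apply: is_deriveB; first exact: is_derive_line.
  apply: is_deriveD; first by apply: is_derive_eq; exact: mulr1.
  rewrite [k * _](_ : _ = k *: (t *: 1 + t *: 1)); last first.
    by rewrite /GRing.scale /= !mulr1.
  by apply: is_deriveZ.
have [c /andP[]] : exists2 c : R, c \in `[0, 1] & phi 1 - phi 0 = dphi c * (1 - 0).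
  apply: MVT_segment => //; apply: derivable_within_continuous => t _.
  exact: (@ex_derive _ _ _ _ _ _ _ (dphiP t)).
rewrite !bnd_simp subr0 mulr1 /phi /dphi !fctE => c0 c1.
rewrite scale1r scale0r add0r /GRing.scale /= !(mulr1, mulr0).
have := dotv_le (grad f (c *: w + x) - grad f x) w.
have := f_lip (c *: w + x) x; rewrite addrK norm2Z ger0_norm // dotvDl dotvNl.
by move=> /(ler_wpM2r (norm2_ge0 w)); rewrite /p /k; lra.
Qed.

(** The mean value theorem without an optimal constant: it only serves to let a
    step tend to zero in [gradient_inequality]. *)
Lemma gradient_lower_bound x w :
  f x + dotv (grad f x) w - K * norm2 w ^+ 2 <= f (w + x).
Proof.
have w0 := norm2_ge0 w.
have [c /andP[]] : exists2 c : R, c \in `[0, 1] &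
    f (1 *: w + x) - f (0 *: w + x) = dotv (grad f (c *: w + x)) w * (1 - 0).
  apply: (@MVT_segment _ (fun s : R => f (s *: w + x))
     (fun s : R => dotv (grad f (s *: w + x)) w)) => //.
    by move=> t _; exact: is_derive_line.
  apply: derivable_within_continuous => t _.
  exact: (@ex_derive _ _ _ _ _ _ _ (is_derive_line x w t)).
rewrite !bnd_simp subr0 mulr1 scale1r scale0r add0r => c0 c1 h3.
have := dotv_le (grad f x - grad f (c *: w + x)) w.
have := f_lip x (c *: w + x); rewrite opprD addrCA subrr addr0 norm2N norm2Z.
rewrite ger0_norm // dotvDl dotvNl => /(ler_wpM2r w0) h1 h2.
have /(ler_wpM2r w0) K0 : 0 <= K * norm2 w.
  have := f_lip x (w + x); rewrite opprD addrCA subrr addr0 norm2N.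
  by apply: le_trans; exact: norm2_ge0.
have : K * (c * norm2 w) * norm2 w <= K * norm2 w ^+ 2.
  rewrite mul0r -mulrA -expr2 in K0.
  by rewrite -mulrA -mulrA -expr2 mulrCA ler_piMl.
lra.
Qed.

Hypothesis f_convex : convex_function setT f.

Lemma convex_functionE x y (t : R) : 0 <= t <= 1 ->
  f (t *: x + (1 - t) *: y) <= t * f x + (1 - t) * f y.
Proof.
move=> /andP[t0 t1].
have t01 : Itv.spec (@Itv.num_sem R) (Itv.Real `[0%Z, 1%Z]) t.
  by rewrite /= /Itv.num_sem /= num_real in_itv /= t0 t1.
have := f_convex (Itv.mk t01); move=> /(_ x y); rewrite !inE => /(_ I I). exact.
Qed.

Lemma gradient_inequality x w : f x + dotv (grad f x) w <= f (w + x).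
Proof.
rewrite -subr_le0; apply: (@le0_of_le_small _ _ (K * norm2 w ^+ 2)).
move=> t /andP[t0 t1]; rewrite -(ler_pM2l t0).
have := gradient_lower_bound x (t *: w).
have -> : t *: w + x = t *: (w + x) + (1 - t) *: x.
  by rewrite scalerDr scalerBl scale1r -addrA subrKC.
have := @convex_functionE (w + x) x t; rewrite (ltW t0) t1 => /(_ isT).
rewrite norm2Z dotvZr ger0_norm ?(ltW t0) // exprMn.
by lra.
Qed.

Hypothesis K_gt0 : 0 < K.

(** The point [x] minimises [f - dotv (grad f x)]; a gradient step of length
    [1 / K] from [y] cannot go below it. *)
Lemma gradient_inequality_strong x y :
  f x + dotv (grad f x) (y - x) + (K *+ 2)^-1 * norm2 (grad f y - grad f x) ^+ 2
  <= f y.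
Proof.
set D := grad f y - grad f x.
have := gradient_inequality x (- (K^-1 *: D) + y - x).
have := descent_lemma y (- (K^-1 *: D)).
rewrite subrK norm2N norm2Z exprMn real_normK ?num_real //.
rewrite (_ : K / 2 * (K^-1 ^+ 2 * norm2 D ^+ 2) = (K *+ 2)^-1 * norm2 D ^+ 2); last first.
  by field; rewrite gt_eqF.
have -> : dotv (grad f y) (- (K^-1 *: D)) =
    dotv (grad f x) (- (K^-1 *: D)) - (K *+ 2)^-1 *+ 2 * norm2 D ^+ 2.
  have -> : (K *+ 2)^-1 *+ 2 = K^-1 by field; rewrite gt_eqF.
  have -> : norm2 D ^+ 2 = dotv (grad f y) D - dotv (grad f x) D.
    by rewrite norm2_sqr {1}/D dotvDl dotvNl.
  by rewrite !(dotvNr, dotvZr); ring.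
have -> : dotv (grad f x) (- (K^-1 *: D) + y - x) =
    dotv (grad f x) (- (K^-1 *: D)) + dotv (grad f x) (y - x).
  by rewrite -addrA dotvDr.
lra.
Qed.

(** Cocoercivity of the gradient, in the form that a forward step from [u]
    to [u'] needs; the constant [K / 4] is what allows the step size condition
    to involve [L / 2] only. *)
Lemma gradient_three_points u u' x :
  dotv (grad f u - grad f x) (x - u') <= K / 4 * norm2 (u - u') ^+ 2.
Proof.
set D := grad f u - grad f x.
have coco : K^-1 * norm2 D ^+ 2 <= dotv D (u - x).
  have := gradient_inequality_strong x u; have := gradient_inequality_strong u x.
  rewrite -/D -(opprB _ (grad f x)) -/D norm2N -(opprB u x) dotvNr.
  have -> : (K *+ 2)^-1 = K^-1 / 2 by field; rewrite gt_eqF.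
  have -> : dotv D (u - x) = dotv (grad f u) (u - x) - dotv (grad f x) (u - x).
    by rewrite {1}/D dotvDl dotvNl.
  lra.
have -> : x - u' = - (u - x) + (u - u') by rewrite opprB addrA subrK.
set e := u - u'; rewrite dotvDr dotvNr.
have := mulr_ge0 (ltW K_gt0) (dotv_ge0 (K^-1 *: D - 2^-1 *: e)).
rewrite -norm2_sqr in coco *.
have sqE (a b : 'cV[R]_d) : norm2 (K^-1 *: a - 2^-1 *: b) ^+ 2 =
    K^-1 ^+ 2 * norm2 a ^+ 2 - K^-1 * dotv a b + 4^-1 * norm2 b ^+ 2.
  rewrite !norm2_sqr !dotvE (dotvC b).
  by field; rewrite gt_eqF.
rewrite sqE.
have -> : K * (K^-1 ^+ 2 * norm2 D ^+ 2 - K^-1 * dotv D e + 4^-1 * norm2 e ^+ 2)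
    = K^-1 * norm2 D ^+ 2 - dotv D e + K / 4 * norm2 e ^+ 2.
  by field; rewrite gt_eqF.
lra.
Qed.
End SmoothFunctions.

(** * Compactness and continuity for column vectors *)

Section ColumnTopology.
Set Implicit Arguments.
Unset Strict Implicit.
Context {R : realType}.

Lemma trmx_rV_continuous m : continuous (@trmx R 1 m).
Proof.
move=> M B [P nP sPB]; exists (fun i j => P j i) => [i j|N /= NP]; first by
  have := nP j i; rewrite mxE.
by apply: sPB => i j; rewrite mxE; exact: NP.
Qed.

(** Transposition carries over Tychonoff's theorem for row vectors. *)
Lemma box_compact m (c : R) :
  compact [set v : 'cV[R]_m | forall i, `|v i 0| <= c].
Proof.
have -> : [set v : 'cV[R]_m | forall i, `|v i 0| <= c] =
    trmx @` [set v : 'rV[R]_m | forall i, `[- c, c]%classic (v ord0 i)].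
  apply/seteqP; split => [v vc|_ [v /= vc <-] i].
    exists v^T; last by rewrite trmxK.
    by move=> i /=; rewrite in_itv /= mxE -ler_norml; exact: vc.
  by have := vc i; rewrite /= in_itv /= mxE ler_norml.
apply: continuous_compact.
  by apply: continuous_subspaceT; exact: trmx_rV_continuous.
by apply: (@rV_compact _ _ (fun=> `[- c, c]%classic)) => i; exact: segment_compact.
Qed.

Lemma bounded_closed_compact_cV m (D : set 'cV[R]_m) :
  bounded_set D -> closed D -> compact D.
Proof.
move=> [M [_ DM]] Dcl.
apply: (subclosed_compact Dcl (@box_compact m (M + 1))) => v.
move=> /(DM _ (ltr_pwDr ltr01 (lexx M))) vM i.
apply: le_trans vM; rewrite [leRHS]/Num.norm /= mx_normrE.
by apply: (le_bigmax _ (fun ij : 'I_m * 'I_1 => `|v ij.1 ij.2|) (i, 0)).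
Qed.

Lemma bounded_norm2 m (D : set 'cV[R]_m) :
  bounded_set D -> exists C, forall v, D v -> norm2 v <= C.
Proof.
move=> [M [_ DM]]; exists (m%:R * `|M + 1|) => v.
move=> /(DM _ (ltr_pwDr ltr01 (lexx M))) vM.
apply: norm2_le_coord => i; apply: le_trans vM.
rewrite [leRHS]/Num.norm /= mx_normrE.
by apply: (le_bigmax _ (fun ij : 'I_m * 'I_1 => `|v ij.1 ij.2|) (i, 0)).
Qed.

Lemma continuous_sum m (T : topologicalType) (F : 'I_m -> T -> R) :
  (forall i, continuous (F i)) -> continuous (fun x => \sum_i F i x).
Proof.
move=> Fc; apply: (@continuous_big R 'I_m +%R 0 xpredT) => //.
exact: add_continuous.
Qed.

Lemma dotv_continuous m (z : 'cV[R]_m) : continuous (dotv z).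
Proof.
apply: (@continuous_sum m _ (fun i (w : 'cV[R]_m) => z i 0 * w i 0)) => i x.
apply: (@continuousM _ _ (cst (z i 0)) (fun w : 'cV[R]_m => w i 0)).
  exact: cst_continuous.
exact: coord_continuous.
Qed.

Lemma norm2_sqr_continuous m (a : 'cV[R]_m) :
  continuous (fun w : 'cV[R]_m => norm2 (w - a) ^+ 2).
Proof.
have -> : (fun w : 'cV[R]_m => norm2 (w - a) ^+ 2) =
    (fun w : 'cV[R]_m => \sum_(i < m) (w i 0 - a i 0) * (w i 0 - a i 0)).
  by apply/funext => w; rewrite norm2_sqr; apply: eq_bigr => i _; rewrite !mxE.
apply: (@continuous_sum m _
  (fun i (w : 'cV[R]_m) => (w i 0 - a i 0) * (w i 0 - a i 0))) => i x.
have cB : {for x, continuous (fun w : 'cV[R]_m => w i 0 - a i 0)}.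
  apply: (@continuousB _ _ _ (fun w : 'cV[R]_m => w i 0) (cst (a i 0))).
    exact: coord_continuous.
  exact: cst_continuous.
exact: (@continuousM _ _ (fun w : 'cV[R]_m => w i 0 - a i 0)
  (fun w : 'cV[R]_m => w i 0 - a i 0)).
Qed.

Lemma compact_fine_bounded_above (T : topologicalType) (F : T -> \bar R) D :
  compact D -> (forall x, D x -> F x \is a fin_num) ->
  {within D, continuous F} -> exists C, forall x, D x -> fine (F x) <= C.
Proof.
move=> Dc Ffin Fcont; have [D0|/set0P D0] := eqVneq D set0.
  by exists 0 => x; rewrite D0.
have Fc : {within D, continuous (fine \o F)}.
  apply/subspace_continuousP => x Dx; apply: fine_cvg; rewrite fineK ?Ffin//.
  by move/subspace_continuousP : Fcont; exact.
have [c _ cmax] := compact_EVT_max D0 Dc Fc.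
by exists (fine (F c)) => x Dx; apply: cmax; rewrite inE.
Qed.

End ColumnTopology.

(** * Proximal maps of proper convex closed functions *)

Lemma not_edom (R : realType) m (F : 'cV[R]_m -> \bar R) w :
  ~ edom F w -> F w = +oo%E.
Proof. by rewrite /edom /= => /negP; rewrite ltNge negbK leye_eq => /eqP. Qed.

Lemma mule_gtNye (R : realType) (c : R) (b : \bar R) :
  0 <= c -> (-oo < b)%E -> (-oo < c%:E * b)%E.
Proof.
rewrite le_eqVlt => /predU1P[<-|c0]; first by rewrite mul0e.
by case: b => [b| |] // _; rewrite -?EFinM ?ltNyr ?gt0_muley ?lte_fin.
Qed.

Section ProximalMaps.
Set Implicit Arguments.
Unset Strict Implicit.
Context {R : realType} {m : nat}.
Variables (F : 'cV[R]_m -> \bar R) (x xi : 'cV[R]_m).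
Hypothesis F_pcc : proper_convex_closed F.
Hypothesis F_sub : subdiff F x xi.

Lemma proper_fin_num w : edom F w -> F w \is a fin_num.
Proof.
have [[ninf _] _ _] := F_pcc; rewrite /edom /= => Fw.
by rewrite fin_numElt ninf Fw.
Qed.

Lemma subdiff_edom : edom F x.
Proof.
have [[ninf [w0 w0F]] _ _] := F_pcc; have := F_sub w0.
have w0fin := proper_fin_num w0F.
by rewrite /edom /= -(fineK w0fin); case: (F x) (ninf x).
Qed.

Lemma subgradient_inequality w : edom F w ->
  fine (F x) + dotv xi (w - x) <= fine (F w).
Proof.
move=> wF; have := F_sub w.
by rewrite -(fineK (proper_fin_num wF)) -(fineK (proper_fin_num subdiff_edom)).
Qed.

Lemma convex_fine y z (t : R) : edom F y -> edom F z -> 0 <= t <= 1 ->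
  edom F (t *: y + (1 - t) *: z) /\
  fine (F (t *: y + (1 - t) *: z)) <= t * fine (F y) + (1 - t) * fine (F z).
Proof.
move=> yF zF t01; have [_ /(_ t y z t01) cvx _] := F_pcc.
move: cvx; rewrite -{1}(fineK (proper_fin_num yF)) -{1}(fineK (proper_fin_num zF)).
move=> cvx; have sF : edom F (t *: y + (1 - t) *: z).
  by apply: (le_lt_trans cvx); rewrite ltry.
by split => //; move: cvx; rewrite -{1}(fineK (proper_fin_num sF)).
Qed.

Variables (c : R) (a : 'cV[R]_m).
Hypothesis c_gt0 : 0 < c.

Local Notation q w r := (norm2 (w - a) ^+ 2 / 2 + c * r).

Lemma prox_obj_fine w : edom F w ->
  prox_obj (escale c F) a w = (q w (fine (F w)))%:E.
Proof. by move=> wF; rewrite /prox_obj /escale -{1}(fineK (proper_fin_num wF)). Qed.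

Lemma prox_obj_pinfty w : ~ edom F w -> prox_obj (escale c F) a w = +oo%E.
Proof.
move=> /not_edom Fw.
by rewrite /prox_obj /escale Fw gt0_muley // lte_fin.
Qed.

(** The affine minorant given by a subgradient makes the proximal objective
    coercive. *)
Lemma prox_sublevel_bounded s : exists C, forall w r,
  (F w <= r%:E)%E -> q w r <= s -> norm2 w <= C /\ `|r| <= C.
Proof.
set k := c * norm2 xi; set b := fine (F x) - dotv xi x.
have k0 : 0 <= k by rewrite mulr_ge0 ?norm2_ge0 ?ltW.
set e := `|s - c * dotv xi a - c * b|.
set N := k *+ 2 + e *+ 2 + 1.
have e0 : 0 <= e by exact: normr_ge0.
have N0 : 0 <= N by rewrite /N; lra.
exists (N + norm2 a + norm2 xi * (N + norm2 a) + `|b| + `|s / c|) => w r Fwr qs.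
have wF : edom F w by apply: (le_lt_trans Fwr); rewrite ltry.
have low : dotv xi w + b <= r.
  have := subgradient_inequality wF.
  have : fine (F w) <= r by rewrite -lee_fin fineK ?proper_fin_num.
  by rewrite dotvDr dotvNr /b; lra.
have n0 := norm2_ge0 (w - a).
have nN : norm2 (w - a) <= N.
  rewrite leNgt; apply/negP => Nn.
  have : - (norm2 xi * norm2 (w - a)) <= dotv xi (w - a).
    by have := dotv_cauchy_schwarz xi (w - a); rewrite ler_norml => /andP[].
  move=> /(ler_wpM2l (ltW c_gt0)); rewrite mulrN mulrA -/k dotvDr dotvNr => cs.
  have := ler_wpM2l (ltW c_gt0) low.
  have := ler_norm (s - c * dotv xi a - c * b); rewrite -/e.
  have : N * norm2 (w - a) <= norm2 (w - a) ^+ 2.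
    by rewrite expr2 ler_wpM2r // ltW.
  have : e *+ 2 + 1 <= (e *+ 2 + 1) * norm2 (w - a).
    by rewrite ler_peMr //; rewrite /N in Nn; lra.
  by rewrite {1}/N; lra.
have wN : norm2 w <= N + norm2 a.
  by apply: le_trans (norm2_dist w a) _; rewrite lerD2r.
have p0 : 0 <= norm2 xi * (N + norm2 a) by rewrite mulr_ge0 ?addr_ge0 ?norm2_ge0.
have a0 := norm2_ge0 a; have b0 := normr_ge0 b; have s0 := normr_ge0 (s / c).
split; first by lra.
rewrite ler_norml; apply/andP; split.
  have := dotv_cauchy_schwarz xi w; rewrite ler_norml => /andP[+ _].
  have := ler_wpM2l (norm2_ge0 xi) wN.
  have := ler_norm (- b); rewrite normrN; lra.
have rs : r <= s / c.
  by rewrite ler_pdivlMr // mulrC; have := sqr_ge0 (norm2 (w - a)); lra.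
by have := ler_norm (s / c); lra.
Qed.

Lemma epigraph_objective_continuous :
  continuous (fun p : 'cV[R]_m * R => q p.1 p.2).
Proof.
move=> p; apply: cvgD.
  apply: cvgMr_tmp.
  apply: (@continuous_comp _ _ _ fst (fun w : 'cV[R]_m => norm2 (w - a) ^+ 2)).
    exact: cvg_fst.
  exact: norm2_sqr_continuous.
by apply: cvgMl_tmp; exact: cvg_snd.
Qed.

(** Minimising over the epigraph of [F] instead of its domain: sublevel sets of
    [q] are compact there because the epigraph is closed, and [q] is continuous. *)
Lemma prox_exists : exists u,
  forall w, (prox_obj (escale c F) a u <= prox_obj (escale c F) a w)%E.
Proof.
have [_ _ Fcl] := F_pcc; set s := q x (fine (F x)).
have [C PC] := prox_sublevel_bounded s.
set P := [set p : 'cV[R]_m * R | (F p.1 <= p.2%:E)%E] `&`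
         [set p : 'cV[R]_m * R | q p.1 p.2 <= s].
have Pcl : closed P.
  apply: closedI => //.
  apply: (@preimage_closed _ _ (fun p : 'cV[R]_m * R => q p.1 p.2) [set r | r <= s]).
    by move=> p _; exact: epigraph_objective_continuous.
  exact: closed_le.
have Pc : compact P.
  apply: (subclosed_compact Pcl
    (compact_setX (@box_compact R m C) (@segment_compact R (- C) C))).
  move=> [w r] [/= Fwr qs]; have [wC rC] := PC _ _ Fwr qs.
  split => /=; last by rewrite in_itv /= -ler_norml.
  by move=> i; exact: le_trans (coord_le_norm2 w i) wC.
have P0 : P !=set0.
  exists (x, fine (F x)); split => //=.
  by rewrite fineK //; exact: proper_fin_num subdiff_edom.
have qc : {within P, continuous (fun p : 'cV[R]_m * R => q p.1 p.2)}.
  exact/continuous_subspaceT/epigraph_objective_continuous.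
have [[u r] /set_mem[/= Fur qus] umin] := compact_EVT_min P0 Pc qc.
exists u => w.
have uF : edom F u by apply: (le_lt_trans Fur); rewrite ltry.
have [wF|wF] := pselect (edom F w); last by rewrite (prox_obj_pinfty wF) leey.
rewrite !prox_obj_fine // lee_fin; apply: (@le_trans _ _ (q u r)).
  by rewrite lerD2l ler_pM2l // -lee_fin fineK ?proper_fin_num.
have [ws|sw] := leP (q w (fine (F w))) s; last exact: le_trans qus (ltW sw).
apply: (umin (w, fine (F w))); rewrite inE; split => //=.
by rewrite fineK ?proper_fin_num.
Qed.

Local Notation u := (prox (escale c F) a).

Lemma prox_minimizer w :
  (prox_obj (escale c F) a u <= prox_obj (escale c F) a w)%E.
Proof. exact: (xgetPex 0 prox_exists). Qed.

Lemma prox_edom : edom F u.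
Proof.
have [//|uF] := pselect (edom F u); have := prox_minimizer x.
by rewrite (prox_obj_pinfty uF) (prox_obj_fine subdiff_edom) leye_eq.
Qed.

Lemma prox_minimizer_fine w : edom F w -> q u (fine (F u)) <= q w (fine (F w)).
Proof.
by move=> wF; have := prox_minimizer w; rewrite !prox_obj_fine //; exact: prox_edom.
Qed.

(** This is the optimality condition [a - u \in c dF(u)], obtained by moving
    from [u] towards [w] by a small step. *)
Lemma prox_variational w : edom F w ->
  c * fine (F u) + dotv (a - u) (w - u) <= c * fine (F w).
Proof.
move=> wF; rewrite -subr_le0.
apply: (@le0_of_le_small _ _ (norm2 (w - u) ^+ 2 / 2)).
move=> t /andP[t0 t1]; rewrite -(ler_pM2l t0).
have [|sF sle] := @convex_fine w u t wF prox_edom; first by rewrite ltW.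
have := prox_minimizer_fine sF.
have -> : t *: w + (1 - t) *: u - a = t *: (w - u) - (a - u).
  by apply/matrixP => i j; rewrite !mxE; ring.
have := ler_wpM2l (ltW c_gt0) sle.
have sqE (y z : 'cV[R]_m) : norm2 (t *: y - z) ^+ 2 =
    t ^+ 2 * norm2 y ^+ 2 - t *+ 2 * dotv z y + norm2 z ^+ 2.
  by rewrite !norm2_sqr !dotvE (dotvC y); ring.
rewrite sqE -(norm2N (u - a)) opprB; lra.
Qed.

(** Monotonicity of the subdifferential of [F] between [u] and [x]. *)
Lemma prox_monotone : 0 <= dotv (a - u - c *: xi) (u - x).
Proof.
have := ler_wpM2l (ltW c_gt0) (subgradient_inequality prox_edom).
have := prox_variational subdiff_edom.
have -> : dotv (a - u - c *: xi) (u - x) =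
    dotv (a - u) (u - x) - c * dotv xi (u - x).
  by rewrite dotvDl dotvNl dotvZl.
by rewrite -(opprB u x) dotvNr; lra.
Qed.

(** Nonexpansiveness of the proximal map, compared with the fixed point
    [x = prox (x + c xi)]. *)
Lemma prox_dist : norm2 (u - x) <= norm2 (a - x - c *: xi).
Proof.
have [->|nz] := eqVneq (norm2 (u - x)) 0; first exact: norm2_ge0.
have npos : 0 < norm2 (u - x) by rewrite lt_def nz norm2_ge0.
rewrite -(ler_pM2r npos) -expr2 norm2_sqr; apply: le_trans (dotv_le _ _).
rewrite -subr_ge0 -dotvNl -dotvDl; apply: le_trans prox_monotone _.
rewrite le_eqVlt; apply/orP; left; apply/eqP; congr dotv.
by apply/matrixP => i j; rewrite !mxE; ring.
Qed.

(** From below by the subgradient at [x], from above by the subgradient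
    [c^-1 (a - u)] at [u]. *)
Lemma prox_value_bound : `|fine (F u)| <=
  `|fine (F x)| + (norm2 xi + c^-1 * norm2 (a - u)) * norm2 (u - x).
Proof.
have := subgradient_inequality prox_edom.
have := dotv_cauchy_schwarz xi (u - x); rewrite ler_norml => /andP[xu _].
have := prox_variational subdiff_edom.
have := dotv_cauchy_schwarz (a - u) (u - x); rewrite ler_norml => /andP[_ au].
rewrite -(opprB u x) (dotvNr (a - u)).
have c0 : 0 <= c^-1 by rewrite invr_ge0 ltW.
move=> /(ler_wpM2l c0); rewrite mulrDr !mulKf ?gt_eqF // => up.
have := ler_wpM2l c0 au.
have := mulr_ge0 c0 (mulr_ge0 (norm2_ge0 (a - u)) (norm2_ge0 (u - x))).
have := mulr_ge0 (norm2_ge0 xi) (norm2_ge0 (u - x)).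
have := ler_norm (fine (F x)); have := ler_norm (- fine (F x)).
rewrite normrN ler_norml => *; apply/andP; split; lra.
Qed.

End ProximalMaps.

(** * Fenchel conjugates and Fermat's rule *)

Section Conjugates.
Set Implicit Arguments.
Unset Strict Implicit.
Context {R : realType} {m : nat}.
Variables (h : 'cV[R]_m -> \bar R).
Hypothesis h_pcc : proper_convex_closed h.

Lemma conjugate_ge w y : ((dotv w y)%:E - h y <= conjugate h w)%E.
Proof. by apply: ereal_sup_ubound; exists y. Qed.

Lemma conjugate_le w c :
  (forall y, edom h y -> dotv w y - fine (h y) <= c) -> (conjugate h w <= c%:E)%E.
Proof.
move=> hc; apply: ge_ereal_sup => _ [y _ <-].
have [yh|/not_edom->] := pselect (edom h y); last by rewrite leNye.
by rewrite -(fineK (proper_fin_num h_pcc yh)) -EFinB lee_fin hc.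
Qed.

Lemma conjugate_ninfty w : (-oo < conjugate h w)%E.
Proof.
have [[_ [y yh]] _ _] := h_pcc; apply: lt_le_trans (conjugate_ge w y).
by rewrite -(fineK (proper_fin_num h_pcc yh)) ltNyr.
Qed.

Lemma fenchel_young w y : edom h y -> edom (conjugate h) w ->
  dotv w y - fine (h y) <= fine (conjugate h w).
Proof.
move=> yh wh; have := conjugate_ge w y.
rewrite -(fineK (proper_fin_num h_pcc yh)) -EFinB.
by rewrite -{1}(@fineK _ (conjugate h w)) // fin_numElt conjugate_ninfty.
Qed.

Lemma conjugate_convex : econvex (conjugate h).
Proof.
move=> t x y /andP[t0 t1].
(* The endpoints need the convention [0 * +oo = 0]. *)
have [->|tn0] := eqVneq t 0.
  by rewrite subr0 scale0r scale1r add0r mul0e mul1e add0e.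
have [->|tn1] := eqVneq t 1.
  by rewrite subrr scale0r scale1r addr0 mul0e mul1e adde0.
have t_gt0 : 0 < t by rewrite lt_def tn0.
have t_lt1 : 0 < 1 - t by rewrite subr_gt0 lt_neqAle tn1.
have nD (a b : \bar R) : (-oo < a)%E -> (-oo < b)%E -> ~~ ((b < +oo)%E && (a < +oo)%E) ->
   (t%:E * a + (1 - t)%:E * b = +oo)%E.
  move: a b => [a| |] [b| |] //= _ _; rewrite ?ltry // => _;
  by rewrite ?gt0_muley ?lte_fin //.
have [/andP[yh xh]|/nD ->] := boolP ((conjugate h y < +oo)%E && (conjugate h x < +oo)%E);
  rewrite ?leey ?conjugate_ninfty //.
have fin w : (conjugate h w < +oo)%E -> conjugate h w \is a fin_num.
  by move=> wh; rewrite fin_numElt conjugate_ninfty.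
rewrite -(fineK (fin _ xh)) -(fineK (fin _ yh)) -!EFinM -EFinD.
apply: conjugate_le => z zh; rewrite !dotvE.
have := fenchel_young zh xh; have := fenchel_young zh yh.
move=> /(ler_wpM2l (ltW t_lt1)) hy /(ler_wpM2l (ltW t_gt0)) hx.
lra.
Qed.

(** The epigraph is an intersection of closed half-spaces. *)
Lemma conjugate_closed : closed_fun (conjugate h).
Proof.
rewrite /closed_fun.
have -> : [set p : 'cV[R]_m * R | (conjugate h p.1 <= p.2%:E)%E] =
    \bigcap_(y in edom h) ((fun p : 'cV[R]_m * R => dotv y p.1 - p.2) @^-1`
      [set r | r <= fine (h y)]).
  apply/seteqP; split => [[w r] /= wr y yh /=|[w r] /= wr].
    have := le_trans (conjugate_ge w y) wr.
    rewrite -{1}(fineK (proper_fin_num h_pcc yh)) -EFinB lee_fin dotvC; lra.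
  by apply: conjugate_le => y yh; have := wr _ yh; rewrite /= dotvC; lra.
apply: closed_bigI => y yh; apply: preimage_closed; last exact: closed_le.
move=> p _; apply: cvgB; last exact: cvg_snd.
apply: (@continuous_comp _ _ _ fst (dotv y)); first exact: cvg_fst.
exact: dotv_continuous.
Qed.

Variables (z zeta : 'cV[R]_m).
Hypothesis h_sub : subdiff h z zeta.

Lemma conjugate_subgradient_edom : edom (conjugate h) zeta.
Proof.
apply: (@le_lt_trans _ _ (dotv zeta z - fine (h z))%:E); last by rewrite ltry.
apply: conjugate_le => y yh.
by have := subgradient_inequality h_pcc h_sub yh; rewrite dotvDr dotvNr; lra.
Qed.

Lemma conjugate_pcc : proper_convex_closed (conjugate h).
Proof.
split; [split|exact: conjugate_convex|exact: conjugate_closed].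
  exact: conjugate_ninfty.
by exists zeta; exact: conjugate_subgradient_edom.
Qed.

(** The easy half of the equivalence between [zeta] in [dh(z)] and [z] in
    [dh^*(zeta)]: equality holds in the Fenchel-Young inequality. *)
Lemma conjugate_subdiff : subdiff (conjugate h) zeta z.
Proof.
move=> w; have zh := subdiff_edom h_pcc h_sub.
apply: le_trans (conjugate_ge w z).
rewrite -(fineK (proper_fin_num conjugate_pcc conjugate_subgradient_edom)).
rewrite -(fineK (proper_fin_num h_pcc zh)) -EFinB -EFinD lee_fin.
suff : fine (conjugate h zeta) <= dotv zeta z - fine (h z).
  by rewrite dotvDr dotvNr (dotvC z) (dotvC z); lra.
rewrite -lee_fin fineK ?(proper_fin_num conjugate_pcc conjugate_subgradient_edom) //.
apply: conjugate_le => y yh.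
by have := subgradient_inequality h_pcc h_sub yh; rewrite dotvDr dotvNr; lra.
Qed.

End Conjugates.

Section Optimality.
Set Implicit Arguments.
Unset Strict Implicit.
Context {R : realType}.

(** The product [t%:E * _] distributes because no term takes the value [-oo]. *)
Lemma econvex_composite d d' (g : 'cV[R]_d -> \bar R) (h : 'cV[R]_d' -> \bar R)
    (A : 'M[R]_(d', d)) (lambda mu : R) :
  proper_convex_closed g -> proper_convex_closed h -> 0 < lambda -> 0 < mu ->
  econvex (fun w => (lambda%:E * g w + mu%:E * h (A *m w)%R)%E).
Proof.
move=> [[gN _] gc _] [[hN _] hc _] l0 m0 t x y t01.
have /andP[t0 t1] := t01.
have D (a b : \bar R) : (-oo < a)%E -> (-oo < b)%E -> (a +? b)%E.
  by move: a b => [a| |] [b| |].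
have t1' : 0 <= 1 - t by rewrite subr_ge0.
have l0' := ltW l0; have m0' := ltW m0.
rewrite mulmxDr -!scalemxAr.
rewrite !muleDr // ?D ?mule_gtNye //.
rewrite addeACA; apply: leeD.
  rewrite !muleA ![(_ * lambda%:E)%E]muleC -!muleA -muleDr ?D ?mule_gtNye //.
  by rewrite lee_pmul2l ?lte_fin // gc.
rewrite !muleA ![(_ * mu%:E)%E]muleC -!muleA -muleDr ?D ?mule_gtNye //.
by rewrite lee_pmul2l ?lte_fin // hc.
Qed.

(** Fermat's rule: compare the values at [x] and at [x + t (w - x)] to first
    order in [t]. *)
Lemma fermat_rule d (f : 'cV[R]_d -> R) (K : R) (F : 'cV[R]_d -> \bar R) x :
  (forall y, differentiable f y) ->
  (forall y z, norm2 (grad f y - grad f z) <= K * norm2 (y - z)) ->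
  econvex F -> (forall w, (-oo < F w)%E) -> edom F x ->
  (forall w, ((f x)%:E + F x <= (f w)%:E + F w)%E) ->
  subdiff F x (- grad f x).
Proof.
move=> f_diff f_lip Fc FN xF xmin w.
have fin y : edom F y -> F y \is a fin_num.
  by move=> yh; rewrite fin_numElt FN.
have [wF|/not_edom->] := pselect (edom F w); last by rewrite leey.
rewrite -(fineK (fin _ xF)) -(fineK (fin _ wF)) -EFinD lee_fin -subr_le0.
apply: (@le0_of_le_small _ _ (K / 2 * norm2 (w - x) ^+ 2)).
move=> t /andP[t0 t1]; rewrite -(ler_pM2l t0).
have := Fc t w x; rewrite (ltW t0) t1 => /(_ isT) cvx.
have := xmin (t *: w + (1 - t) *: x).
move=> /le_trans/(_ (leeD2l _ cvx)).
rewrite -(fineK (fin _ xF)) -(fineK (fin _ wF)) -!EFinM -!EFinD lee_fin.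
have := descent_lemma f_diff f_lip x (t *: (w - x)).
have -> : t *: (w - x) + x = t *: w + (1 - t) *: x.
  by apply/matrixP => i j; rewrite !mxE; ring.
rewrite dotvZr norm2Z exprMn real_normK ?num_real // dotvNl; lra.
Qed.

End Optimality.

(** * Boundedness of the primal-dual iterates *)

(** Summing the recursion up to the first index [n] at which [r n] exceeds the
    bound gives [c (r n)^2 <= T (1 + r n)], which limits [r n]. The factor
    [1 + r n.+1] is implicit, so this avoids any smallness of [a]. *)
Lemma quasi_fejer_bounded (R : realFieldType) (c K S : R) (Phi r a : nat -> R) :
  0 < c -> 0 <= K -> (forall n, 0 <= a n) ->
  (forall n, \sum_(i < n) a i <= S) -> (forall n, 0 <= r n) ->
  (forall n, c * r n ^+ 2 <= Phi n) ->
  (forall n, Phi n.+1 <= Phi n + K * a n * (1 + r n.+1)) ->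
  exists B, forall n, r n <= B.
Proof.
move=> c0 K0 a0 aS r0 cr step.
have S0 : 0 <= S by have := aS 0; rewrite big_ord0.
have acc n rho : (forall j, (j < n)%N -> r j.+1 <= rho) ->
    Phi n <= Phi 0 + K * (1 + rho) * \sum_(i < n) a i.
  elim: n => [|n IH] rrho; first by rewrite big_ord0 mulr0 addr0.
  rewrite big_ord_recr mulrDr addrA /=.
  apply: le_trans (step n) (lerD (IH _) _) => [j jn|].
    by apply: rrho; exact: ltnW.
  rewrite -!mulrA ler_wpM2l // mulrC ler_wpM2r // lerD2l.
  exact: rrho.
set T := `|Phi 0| + K * S.
have T0 : 0 <= T by rewrite addr_ge0 // mulr_ge0.
exists (1 + T *+ 2 / c).
have TC0 : 0 <= T *+ 2 / c by rewrite divr_ge0 ?mulrn_wge0 // ltW.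
elim/ltn_ind => n IH.
rewrite leNgt; apply/negP => rn.
have r1 : 1 <= r n by lra.
have /(acc n) Pn : forall j, (j < n)%N -> r j.+1 <= r n.
  move=> j; rewrite leq_eqVlt => /predU1P[->//|jn].
  by apply: le_trans (ltW rn); exact: IH.
have : c * r n ^+ 2 <= T * (r n *+ 2).
  apply: le_trans (cr n) (le_trans Pn _).
  have h1 : K * (1 + r n) * \sum_(i < n) a i <= K * S * (r n *+ 2).
    rewrite mulrAC ler_pM ?mulr_ge0 ?addr_ge0 ?sumr_ge0 //; last by lra.
    by rewrite ler_wpM2l.
  have h2 : Phi 0 <= `|Phi 0| * (r n *+ 2).
    by apply: le_trans (ler_norm _) _; rewrite ler_peMr //; lra.
  by rewrite /T; lra.
have rpos : 0 < r n by lra.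
move=> rT; have : c * r n <= T *+ 2 by rewrite -(ler_pM2r rpos); lra.
rewrite mulrC -ler_pdivlMr //; lra.
Qed.

Section PrimalDualStep.
Set Implicit Arguments.
Unset Strict Implicit.
Context {R : realType} {d d' : nat}.
Variables (A : 'M[R]_(d', d)) (alpha beta : R).
Hypotheses (alpha_gt0 : 0 < alpha) (beta_gt0 : 0 < beta).

(** The squared norm of the Condat-Vu preconditioner, in which the iteration
    is a forward-backward step; the dual variable enters as [W = mu_n V]. *)
Definition pd_energy (U : 'cV[R]_d) (W : 'cV[R]_d') : R :=
  alpha^-1 * norm2 U ^+ 2 - dotv (A *m U) W *+ 2 + beta^-1 * norm2 W ^+ 2.

(** Young's inequality absorbs the coupling term in the dual part. *)
Lemma pd_energy_ge U W :
  (alpha^-1 - beta * spectral_norm A ^+ 2) * norm2 U ^+ 2 <= pd_energy U W.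
Proof.
have h := le_trans (dotv_le (A *m U) W)
  (ler_wpM2r (norm2_ge0 W) (norm2_mulmx A U)).
have b0 : 0 <= beta^-1 by rewrite invr_ge0 ltW.
have := mulr_ge0 b0 (sqr_ge0 (beta * spectral_norm A * norm2 U - norm2 W)).
have -> : beta^-1 * (beta * spectral_norm A * norm2 U - norm2 W) ^+ 2 =
  beta * spectral_norm A ^+ 2 * norm2 U ^+ 2
  - spectral_norm A * norm2 U * norm2 W *+ 2 + beta^-1 * norm2 W ^+ 2.
  by field; rewrite gt_eqF.
rewrite /pd_energy; lra.
Qed.

(** The two monotonicity inequalities add up to the inner product of the
    increment with the new point, in the metric of [pd_energy]; the polarisation
    identity leaves the energy of the increment, which dominates the gradient
    term. *)
Lemma pd_energy_step (K m : R) (U U' D E : 'cV[R]_d) (V V' : 'cV[R]_d') :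
  K / 2 <= alpha^-1 - beta * spectral_norm A ^+ 2 -> 0 < m ->
  0 <= dotv (U - U' - alpha *: (D + m *: (A^T *m V) + E)) U' ->
  0 <= dotv (V - V' + (beta / m) *: (A *m (2 *: U' - U))) V' ->
  - dotv D U' <= K / 4 * norm2 (U - U') ^+ 2 ->
  pd_energy U' (m *: V') <= pd_energy U (m *: V) - dotv E U' *+ 2.
Proof.
move=> Kle m0 h1 h2 h3.
have h4 := le_trans (ler_wpM2r (sqr_ge0 (norm2 (U - U'))) Kle)
  (pd_energy_ge (U - U') (m *: (V - V'))).
have {}h1 : 0 <= alpha^-1 * (dotv U U' - dotv U' U') - dotv D U'
    - m * dotv (A *m U') V - dotv E U'.
  have := mulr_ge0 (_ : 0 <= alpha^-1) h1; rewrite invr_ge0 => /(_ (ltW alpha_gt0)).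
  rewrite !dotvE [dotv (A^T *m V) U']dotvC -dotv_mulmx.
  by congr (0 <= _); field; rewrite gt_eqF.
have {}h2 : 0 <= m ^+ 2 / beta * (dotv V V' - dotv V' V')
    + m * (2 * dotv (A *m U') V' - dotv (A *m U) V').
  have := mulr_ge0 (_ : 0 <= m ^+ 2 / beta) h2.
  rewrite divr_ge0 ?sqr_ge0 ?(ltW beta_gt0) // => /(_ isT).
  rewrite mulmxDr mulmxN -scalemxAr !dotvE.
  by congr (0 <= _); field; rewrite !gt_eqF.
move: h3 h4.
rewrite /pd_energy mulmxDr mulmxN !norm2_sqr !dotvE (dotvC U' U) (dotvC V' V).
lra.
Qed.

End PrimalDualStep.

Section BoundedIterates.
Set Implicit Arguments.
Unset Strict Implicit.
Context {R : realType} {d d' : nat}.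
Variables (A : 'M[R]_(d', d)) (alpha beta lambda mu L S C : R).
Variables (lam_ mu_ : nat -> R) (u : nat -> 'cV[R]_d) (v : nat -> 'cV[R]_d').
Variables (f : 'cV[R]_d -> R) (x xi : 'cV[R]_d) (y : 'cV[R]_d').
Hypotheses (alpha_gt0 : 0 < alpha) (beta_gt0 : 0 < beta).
Hypotheses (mu__gt0 : forall n, 0 < mu_ n).
Hypothesis L_ge0 : 0 <= L.
Hypothesis f_convex : convex_function setT f.
Hypothesis f_diff : forall x, differentiable f x.
Hypothesis f_lip : forall x y, norm2 (grad f x - grad f y) <= L * norm2 (x - y).
Hypothesis stepsizes : beta * spectral_norm A ^+ 2 < 1 / alpha - L / 2.
Hypothesis lam_sum : forall n, \sum_(i < n) `|lam_ i - lambda| <= S.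
Hypothesis mu_sum : forall n, \sum_(i < n) `|mu_ i - mu| <= S.
Hypothesis v_bounded : forall n, norm2 (v n - y) <= C.
Hypothesis kkt : lambda *: xi + mu *: (A^T *m y) = - grad f x.
Hypothesis primal_step : forall n, 0 <= dotv
  (u n - alpha *: grad f (u n) - (alpha * mu_ n) *: (A^T *m v n) - u n.+1
     - (alpha * lam_ n) *: xi) (u n.+1 - x).
Hypothesis dual_step : forall n, 0 <= dotv
  (v n + (beta / mu_ n) *: (A *m (2 *: u n.+1 - u n)) - v n.+1
     - (beta / mu_ n) *: (A *m x)) (v n.+1 - y).

(* Twice the slack of the metric: it exceeds [L], hence is a positive Lipschitz
   constant even when [L = 0]. *)
Let K := (alpha^-1 - beta * spectral_norm A ^+ 2) *+ 2.

(** Subtracting the saddle point conditions from the two proximal inclusions;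
    the discrepancy of the parameters only multiplies [xi] and [A^T *m y]. *)
Lemma iterates_energy_step n :
  pd_energy A alpha beta (u n.+1 - x) (mu_ n *: (v n.+1 - y)) <=
  pd_energy A alpha beta (u n - x) (mu_ n *: (v n - y)) +
  (norm2 xi + norm2 (A^T *m y)) * (`|lam_ n - lambda| + `|mu_ n - mu|)
    * norm2 (u n.+1 - x) *+ 2.
Proof.
have LK : L < K by move: stepsizes; rewrite div1r /K; lra.
have K_gt0 : 0 < K := le_lt_trans L_ge0 LK.
have f_lipK a b : norm2 (grad f a - grad f b) <= K * norm2 (a - b).
  by apply: le_trans (f_lip a b) _; rewrite ler_wpM2r ?norm2_ge0 // ltW.
set E := (lam_ n - lambda) *: xi + (mu_ n - mu) *: (A^T *m y).
have mn0 := mu__gt0 n.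
have K2 : K / 2 <= alpha^-1 - beta * spectral_norm A ^+ 2 by rewrite /K; lra.
have := @pd_energy_step R d d' A alpha beta alpha_gt0 beta_gt0 K (mu_ n)
  (u n - x) (u n.+1 - x) (grad f (u n) - grad f x) E (v n - y) (v n.+1 - y).
have -> : u n - x - (u n.+1 - x) - alpha *: (grad f (u n) - grad f x +
      mu_ n *: (A^T *m (v n - y)) + E) =
    u n - alpha *: grad f (u n) - (alpha * mu_ n) *: (A^T *m v n) - u n.+1
     - (alpha * lam_ n) *: xi.
  rewrite -[- grad f x]kkt /E mulmxBr.
  by apply/matrixP => i j; rewrite !(mxE, ord1); ring.
have -> : v n - y - (v n.+1 - y) + (beta / mu_ n) *:
      (A *m (2 *: (u n.+1 - x) - (u n - x))) =
    v n + (beta / mu_ n) *: (A *m (2 *: u n.+1 - u n)) - v n.+1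
     - (beta / mu_ n) *: (A *m x).
  have -> : 2 *: (u n.+1 - x) - (u n - x) = (2 *: u n.+1 - u n) - x.
    by apply/matrixP => i j; rewrite !mxE; ring.
  rewrite mulmxBr; move: (A *m _) (A *m _) => p q.
  by apply/matrixP => i j; rewrite !mxE; ring.
move=> /(_ K2 mn0 (primal_step n) (dual_step n)).
have -> : u n - x - (u n.+1 - x) = u n - u n.+1.
  by apply/matrixP => i j; rewrite !mxE; ring.
have := gradient_three_points f_diff f_lipK f_convex K_gt0 (u n) (u n.+1) x.
rewrite -(opprB (u n.+1) x) dotvNr => tp /(_ tp)/le_trans; apply.
rewrite lerD2l -mulNrn lerMn2r /=.
rewrite -dotvNl; apply: le_trans (dotv_le _ _) _.
rewrite ler_wpM2r ?norm2_ge0 // norm2N.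
apply: le_trans (norm2D _ _) _; rewrite !norm2Z.
have := mulr_ge0 (norm2_ge0 xi) (normr_ge0 (mu_ n - mu)).
have := mulr_ge0 (norm2_ge0 (A^T *m y)) (normr_ge0 (lam_ n - lambda)).
lra.
Qed.

(** Passing from [mu_ n] to [mu_ n.+1] in the scaling of the dual variable. *)
Lemma pd_energy_rescale (m m' : R) (U : 'cV[R]_d) (V : 'cV[R]_d') M :
  norm2 V <= C -> 0 <= m <= M -> 0 <= m' <= M ->
  pd_energy A alpha beta U (m' *: V) <= pd_energy A alpha beta U (m *: V) +
    (spectral_norm A * C *+ 2 * norm2 U + beta^-1 * (M *+ 2) * C ^+ 2) * `|m' - m|.
Proof.
move=> VC /andP[m0 mM] /andP[m'0 m'M].
have C0 : 0 <= C := le_trans (norm2_ge0 V) VC.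
rewrite /pd_energy !dotvZr !norm2Z !exprMn !real_normK ?num_real //.
have b0 : 0 <= beta^-1 by rewrite invr_ge0 ltW.
have h1 : - ((m' - m) * dotv (A *m U) V) <=
    `|m' - m| * (spectral_norm A * norm2 U * C).
  rewrite -mulNr; apply: le_trans (ler_norm _) _.
  rewrite normrM normrN ler_wpM2l //; apply: le_trans (dotv_cauchy_schwarz _ _) _.
  by rewrite ler_pM ?norm2_ge0 // norm2_mulmx.
have h2 : (m' ^+ 2 - m ^+ 2) * norm2 V ^+ 2 <= `|m' - m| * (M *+ 2) * C ^+ 2.
  apply: (@le_trans _ _ (`|m' - m| * (M *+ 2) * norm2 V ^+ 2)).
    rewrite ler_wpM2r ?sqr_ge0 // subr_sqr.
    apply: le_trans (ler_norm _) _; rewrite normrM ler_wpM2l //.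
    by rewrite ger0_norm ?addr_ge0 //; lra.
  rewrite ler_wpM2l ?mulr_ge0 ?mulrn_wge0 //; first exact: le_trans mM.
  by rewrite ler_sqr ?nnegrE ?norm2_ge0.
have := ler_wpM2l b0 h2; lra.
Qed.

(** The energy recursion in the form of [quasi_fejer_bounded]: the three
    summands of [a] control the parameter errors of the step and the change of
    scaling from [mu_ n] to [mu_ n.+1]. *)
Lemma iterates_bounded : exists B, forall n, norm2 (u n - x) <= B.
Proof.
have K_gt0 : 0 < alpha^-1 - beta * spectral_norm A ^+ 2.
  by move: stepsizes (L_ge0); rewrite div1r => h1 h2; lra.
pose a n := `|lam_ n - lambda| + `|mu_ n - mu| + `|mu_ n.+1 - mu|.
have S0 : 0 <= S by have := mu_sum 0; rewrite big_ord0.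
have muS n : `|mu_ n - mu| <= S.
  apply: le_trans (mu_sum n.+1); rewrite big_ord_recr /= lerDr.
  exact: sumr_ge0.
pose M := S + mu.
have muM n : 0 <= mu_ n <= M.
  rewrite ltW //= /M; have := muS n; have := ler_norm (mu_ n - mu); lra.
have C0 : 0 <= C := le_trans (norm2_ge0 _) (v_bounded 0).
have s0 := spectral_norm_ge0 A.
have b0 : 0 <= beta^-1 by rewrite invr_ge0 ltW.
pose k1 := (norm2 xi + norm2 (A^T *m y)) *+ 2.
pose k2 := spectral_norm A * C *+ 2.
pose k3 := beta^-1 * (M *+ 2) * C ^+ 2.
have k10 : 0 <= k1 by rewrite mulrn_wge0 // addr_ge0 ?norm2_ge0.
have k20 : 0 <= k2 by rewrite mulrn_wge0 // mulr_ge0.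
have M0 : 0 <= M by have /andP[] := muM 0; exact: le_trans.
have k30 : 0 <= k3 by rewrite !mulr_ge0 ?sqr_ge0 ?mulrn_wge0.
apply: (@quasi_fejer_bounded _ _ (k1 + k2 + k3) (S *+ 3)
  (fun n => pd_energy A alpha beta (u n - x) (mu_ n *: (v n - y))) _ a K_gt0).
- exact: addr_ge0 (addr_ge0 k10 k20) k30.
- by move=> n; rewrite /a !addr_ge0 //.
- move=> n; rewrite !big_split /=.
  have : \sum_(i < n) `|mu_ i.+1 - mu| <= S.
    apply: le_trans (mu_sum n.+1); rewrite big_ord_recl /= lerDr //.
  have := lam_sum n; have := mu_sum n; lra.
- by move=> n; exact: norm2_ge0.
- by move=> n; exact: pd_energy_ge.
- move=> n; set r := norm2 (u n.+1 - x).
  have r0 : 0 <= r := norm2_ge0 _.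
  have := pd_energy_rescale (u n.+1 - x) (v_bounded n.+1) (muM n) (muM n.+1).
  have := iterates_energy_step n; rewrite -/r -/k2 -/k3.
  have mm : `|mu_ n.+1 - mu_ n| <= a n.
    have -> : mu_ n.+1 - mu_ n = (mu_ n.+1 - mu) - (mu_ n - mu) by ring.
    apply: le_trans (ler_normB _ _) _; rewrite /a.
    by have := normr_ge0 (lam_ n - lambda); lra.
  have la : `|lam_ n - lambda| + `|mu_ n - mu| <= a n by rewrite lerDl.
  have a0 : 0 <= a n by apply: le_trans mm.
  have k2r : 0 <= k2 * r by rewrite mulr_ge0.
  have := ler_wpM2l (addr_ge0 k2r k30) mm.
  have := ler_wpM2l (mulr_ge0 k10 r0) la; rewrite /k1.
  have := mulr_ge0 k10 a0; have := mulr_ge0 k20 a0.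
  have := mulr_ge0 (mulr_ge0 k30 a0) r0; rewrite /k1.
  lra.
Qed.

End BoundedIterates.

(** * Proximal maps with a perturbed parameter *)

Section ApproximateProx.
Set Implicit Arguments.
Unset Strict Implicit.
Context {R : realType} {m : nat}.
Variables (F : 'cV[R]_m -> \bar R) (x xi : 'cV[R]_m).
Hypothesis F_pcc : proper_convex_closed F.
Hypothesis F_sub : subdiff F x xi.
Variables (c c' : R).
Hypotheses (c_gt0 : 0 < c) (c'_gt0 : 0 < c').

(** Comparing the two minimality properties, the objective with parameter [c]
    is larger at [prox (escale c' F) a] than at its minimiser by at most
    [(c - c')] times the difference of the values of [F]. *)
Lemma prox_rescaled_approx1 (a : 'cV[R]_m) (M : R) :
  let u := prox (escale c F) a in let u' := prox (escale c' F) a in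
  `|fine (F u') - fine (F u)| <= M ->
  prox_approx1 (`|c' - c| * M) (escale c F) a u'.
Proof.
move=> u u' uM.
have uF : edom F u := prox_edom F_pcc F_sub a c_gt0.
have u'F : edom F u' := prox_edom F_pcc F_sub a c'_gt0.
have le_phi : norm2 (u' - a) ^+ 2 / 2 + c * fine (F u') <=
    norm2 (u - a) ^+ 2 / 2 + c * fine (F u) + `|c' - c| * M.
  have := prox_minimizer_fine F_pcc F_sub a c'_gt0 uF; rewrite -/u'.
  have : - ((c' - c) * (fine (F u') - fine (F u))) <= `|c' - c| * M.
    by rewrite -mulNr; apply: le_trans (ler_norm _) _; rewrite normrM normrN ler_wpM2l.
  lra.
split.
- by rewrite mulr_ge0 //; exact: le_trans (normr_ge0 _) uM.
- by rewrite /edom /= prox_obj_fine // ltry.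
- move=> w _; have [wF|wF] := pselect (edom F w); last first.
    by rewrite (prox_obj_pinfty a c_gt0 wF) leey.
  rewrite !prox_obj_fine // dotv0l adde0 -EFinB lee_fin lerBlDr.
  apply: le_trans le_phi _; rewrite lerD2r.
  exact: (prox_minimizer_fine F_pcc F_sub a c_gt0 wF).
Qed.

Lemma prox_rescaled_approx2 (b p : 'cV[R]_m) (M : R) :
  let v := prox (escale c' F) (b + c' *: p) in
  (forall w, edom F w ->
     `|fine (F v) - fine (F w)| + `|dotv p (w - v)| <= M) ->
  prox_approx2 (`|c' - c| * M) (escale c F) (b + c *: p) v.
Proof.
move=> v vM.
have vF : edom F v := prox_edom F_pcc F_sub _ c'_gt0.
have M0 : 0 <= M by apply: le_trans (vM v vF); rewrite addr_ge0.
have escaleE w : edom F w -> escale c F w = (c * fine (F w))%:E.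
  by move=> wF; rewrite /escale -{1}(fineK (proper_fin_num F_pcc wF)).
split.
- by rewrite mulr_ge0.
- by rewrite /edom /= escaleE // ltry.
- move=> w _; have [wF|/not_edom Fw] := pselect (edom F w); last first.
    by rewrite {2}/escale Fw gt0_muley ?lte_fin // leey.
  rewrite !escaleE // -EFinD lee_fin.
  have := prox_variational F_pcc F_sub (b + c' *: p) c'_gt0 wF; rewrite -/v.
  have -> : b + c' *: p - v = (b - v) + c' *: p by rewrite addrAC.
  have -> : b + c *: p - v = (b - v) + c *: p by rewrite addrAC.
  rewrite !(dotvDl (b - v)) !dotvZl.
  have : (c' - c) * (fine (F w) - fine (F v) - dotv p (w - v)) <= `|c' - c| * M.
    apply: le_trans (ler_norm _) _; rewrite normrM ler_wpM2l //.
    apply: le_trans (ler_normB _ _) _; rewrite distrC; exact: vM.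
  lra.
Qed.

End ApproximateProx.

Section SummableParameters.
Set Implicit Arguments.
Unset Strict Implicit.
Context {R : realType}.

Lemma nneseries_partial_sums_bounded (a : nat -> R) :
  (forall n, 0 <= a n) -> (\sum_(0 <= n <oo) (a n)%:E < +oo)%E ->
  exists S, forall n, \sum_(i < n) a i <= S.
Proof.
move=> a0 aoo; exists (fine (\sum_(0 <= n <oo) (a n)%:E)%E) => n.
have ge0 : (0 <= \sum_(0 <= n <oo) (a n)%:E)%E.
  by apply: nneseries_ge0 => k _ _; rewrite lee_fin.
rewrite -lee_fin fineK; last by rewrite ge0_fin_numE.
rewrite -sumEFin -(big_mkord xpredT (fun i => (a i)%:E)).
by apply: nneseries_lim_ge => k _ _; rewrite lee_fin.
Qed.

(** The sequence converges to a positive limit, so its inverse converges. *)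
Lemma positive_summable_inv_bounded (lambda S : R) (lam_ : nat -> R) :
  0 < lambda -> (forall n, 0 < lam_ n) ->
  (forall n, \sum_(i < n) `|lam_ i - lambda| <= S) ->
  exists k, forall n, (lam_ n)^-1 <= k.
Proof.
move=> l0 lam0 lamS.
have cs : cvgn (series (fun n => `|lam_ n - lambda|)).
  apply: nondecreasing_is_cvgn; first by apply: nondecreasing_series => n _ _.
  by exists S => _ [n _ <-]; rewrite /series /= big_mkord.
have /norm_cvg0P/subr_cvg0 lamc := cvg_series_cvg_0 cs.
have /cvg_seq_bounded[k [_ kb]] : cvgn (fun n => (lam_ n)^-1).
  by apply/cvg_ex; exists lambda^-1; exact: cvgV (lt0r_neq0 l0) lamc.
exists (k + 1) => n; apply: le_trans (ler_norm _) _.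
by apply: (kb (k + 1)) => //; rewrite ltrDl.
Qed.

End SummableParameters.

(** * The inexact primal-dual iteration *)

Theorem mainTheorem3 (R : realType) (d d' : nat)
  (f : 'cV[R]_d -> R) (L : R)
  (g : 'cV[R]_d -> \bar R) (h : 'cV[R]_d' -> \bar R)
  (A : 'M[R]_(d', d)) (lambda mu alpha beta : R)
  (lam_ mu_ : nat -> R) (u : nat -> 'cV[R]_d) (v : nat -> 'cV[R]_d')
  (f_convex : convex_function setT f)
  (f_diff : forall x, differentiable f x)
  (L_ge0 : 0 <= L)
  (f_lip : forall x y, norm2 (grad f x - grad f y) <= L * norm2 (x - y))
  (g_pcc : proper_convex_closed g)
  (h_pcc : proper_convex_closed h)
  (lambda_gt0 : 0 < lambda) (mu_gt0 : 0 < mu)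
  (subdiff_sum : forall x : 'cV[R]_d,
     subdiff (fun w => (lambda%:E * g w + mu%:E * h (A *m w)%R)%E) x =
     [set lambda *: xi + mu *: (A^T *m zeta) |
        xi in subdiff g x & zeta in subdiff h (A *m x)])
  (has_minimizer : exists x : 'cV[R]_d,
     let obj w := ((f w)%:E + lambda%:E * g w + mu%:E * h (A *m w)%R)%E in
     obj x \is a fin_num /\ forall w, (obj x <= obj w)%E)
  (alpha_gt0 : 0 < alpha) (beta_gt0 : 0 < beta)
  (stepsizes : beta * spectral_norm A ^+ 2 < 1 / alpha - L / 2)
  (lam_gt0 : forall n, 0 < lam_ n) (mu__gt0 : forall n, 0 < mu_ n)
  (lam_summable : (\sum_(0 <= n <oo) `|lam_ n - lambda|%:E < +oo)%E)
  (mu_summable : (\sum_(0 <= n <oo) `|mu_ n - mu|%:E < +oo)%E)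
  (g_cont : {within edom g, continuous g})
  (hs_bounded : bounded_set (edom (conjugate h)))
  (hs_closed : closed (edom (conjugate h)))
  (hs_cont : {within edom (conjugate h), continuous (conjugate h)})
  (u_rec : forall n, u n.+1 =
     prox (escale (alpha * lam_ n) g)
       (u n - alpha *: grad f (u n) - (alpha * mu_ n) *: (A^T *m v n)))
  (v_rec : forall n, v n.+1 =
     prox (escale (beta / mu_ n) (conjugate h))
       (v n + (beta / mu_ n) *: (A *m (2 *: u n.+1 - u n)))) :
  let ubar n :=
    prox (escale (alpha * lambda) g)
      (u n - alpha *: grad f (u n) - (alpha * mu_ n) *: (A^T *m v n)) in
  let M1 := ereal_sup (range (fun n => `|g (u n.+1) - g (ubar n)|%E)) in
  let M2 := ereal_sup
    [set (`|conjugate h (v n.+1) - conjugate h w| +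
          (spectral_norm A * norm2 (2 *: u n.+1 - u n)%R
             * norm2 (w - v n.+1)%R)%:E)%E |
       n in [set: nat] & w in edom (conjugate h)] in
  [/\ (M1 < +oo)%E, (M2 < +oo)%E &
    forall n,
      let e := (mu_ n - mu) *: (A^T *m v n) in
      let eps := alpha * fine M1 * `|lam_ n - lambda| in
      let delta := beta * fine M2 * `|(mu_ n)^-1 - mu^-1| in
      prox_approx1 eps (escale (alpha * lambda) g)
        (u n - alpha *: grad f (u n) - (alpha * mu) *: (A^T *m v n)
           - alpha *: e) (u n.+1)
      /\
      prox_approx2 delta (escale (beta / mu) (conjugate h))
        (v n + (beta / mu) *: (A *m (2 *: u n.+1 - u n))) (v n.+1)].
Proof.
have [[g_ninf _] _ _] := g_pcc; have [[h_ninf _] _ _] := h_pcc.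
have [x [xfin xmin]] := has_minimizer.
set F := fun w => (lambda%:E * g w + mu%:E * h (A *m w)%R)%E.
have F_ninf w : (-oo < F w)%E.
  move: (mule_gtNye (ltW lambda_gt0) (g_ninf w)).
  move: (mule_gtNye (ltW mu_gt0) (h_ninf (A *m w))); rewrite /F.
  by case: (_ * g w)%E => [r| |] //; case: (_ * h _)%E => [r'| |] // _ _;
    rewrite -?EFinD ?ltNyr ?ltNye.
have [xi gx [y hy kkt]] : [set lambda *: xi + mu *: (A^T *m zeta) |
    xi in subdiff g x & zeta in subdiff h (A *m x)] (- grad f x).
  rewrite -subdiff_sum; apply: (@fermat_rule _ _ f L) => //.
  - exact: econvex_composite.
  - rewrite /edom /=; move: xfin; rewrite -addeA -/(F x) fin_numElt => /andP[_].
    by have := F_ninf x; case: (F x).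
  - by move=> w; rewrite !addeA; exact: xmin.
have hs_pcc := conjugate_pcc h_pcc hy.
have hs_sub := conjugate_subdiff h_pcc hy.
have al_gt0 n : 0 < alpha * lam_ n by rewrite mulr_gt0.
have al0 : 0 < alpha * lambda by rewrite mulr_gt0.
have bm_gt0 n : 0 < beta / mu_ n by rewrite divr_gt0.
have bm0 : 0 < beta / mu by rewrite divr_gt0.
set a := fun n => u n - alpha *: grad f (u n) - (alpha * mu_ n) *: (A^T *m v n).
have [S1 lamS] := nneseries_partial_sums_bounded (fun n => normr_ge0 _) lam_summable.
have [S2 muS] := nneseries_partial_sums_bounded (fun n => normr_ge0 _) mu_summable.
have [k lamk] := positive_summable_inv_bounded lambda_gt0 lam_gt0 lamS.
have v_dom n : edom (conjugate h) (v n.+1).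
  by rewrite v_rec; exact: (prox_edom hs_pcc hs_sub).
have [C0 domC] := bounded_norm2 hs_bounded.
have [C vC] : exists C, forall n, norm2 (v n) <= C.
  exists (`|C0| + norm2 (v 0)) => -[|n]; first by rewrite lerDr.
  apply: le_trans (domC _ (v_dom n)) _.
  by apply: le_trans (ler_norm _) _; rewrite lerDl norm2_ge0.
have C_ge0 : 0 <= C := le_trans (norm2_ge0 _) (vC 0).
have [B uB] : exists B, forall n, norm2 (u n - x) <= B.
  apply: (@iterates_bounded R d d' A alpha beta lambda mu L (`|S1| + `|S2|)
    (C + norm2 y) lam_ mu_ u v f x xi y) => //.
  - by move=> n; apply: le_trans (lamS n) _; rewrite (le_trans (ler_norm _)) // lerDl.
  - by move=> n; apply: le_trans (muS n) _; rewrite (le_trans (ler_norm _)) // lerDr.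
  - by move=> n; apply: le_trans (norm2B _ _) _; rewrite lerD2r.
  - by move=> n; rewrite u_rec; exact: (prox_monotone g_pcc gx).
  - by move=> n; rewrite v_rec; exact: (prox_monotone hs_pcc hs_sub).
have B_ge0 : 0 <= B := le_trans (norm2_ge0 _) (uB 0).
have mu_le n : mu_ n <= S2 + mu.
  have : `|mu_ n - mu| <= S2.
    by apply: le_trans (muS n.+1); rewrite big_ord_recr /= lerDr sumr_ge0.
  by have := ler_norm (mu_ n - mu); lra.
have [Ba aB] : exists Ba, forall n, norm2 (a n - x) <= Ba.
  exists (B + alpha * (L * B + norm2 (grad f x))
     + alpha * (S2 + mu) * (spectral_norm A^T * C)) => n.
  have -> : a n - x = (u n - x) - alpha *: grad f (u n)
      - (alpha * mu_ n) *: (A^T *m v n).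
    by apply/matrixP => i j; rewrite /a !mxE; ring.
  apply: le_trans (norm2B _ _) (lerD _ _).
    apply: le_trans (norm2B _ _) (lerD (uB n) _).
    rewrite norm2Z gtr0_norm // ler_pM2l //.
    apply: le_trans (norm2_dist _ (grad f x)) _; rewrite lerD2r.
    by apply: le_trans (f_lip _ _) _; rewrite ler_wpM2l.
  rewrite norm2Z gtr0_norm ?mulr_gt0 //.
  rewrite ler_pM ?norm2_ge0 ?mulr_ge0 ?(ltW alpha_gt0) ?(ltW (mu__gt0 _)) //.
    by rewrite ler_wpM2l // ltW.
  apply: le_trans (norm2_mulmx _ _) _.
  by rewrite ler_wpM2l ?spectral_norm_ge0.
have Ba_ge0 : 0 <= Ba := le_trans (norm2_ge0 _) (aB 0).
move=> ubar M1 M2.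
have ubarB n : norm2 (ubar n - x) <= Ba + alpha * lambda * norm2 xi.
  apply: le_trans (prox_dist g_pcc gx _ al0) _.
  apply: le_trans (norm2B _ _) (lerD (aB n) _).
  by rewrite norm2Z gtr0_norm.
have gu_fin n : g (u n.+1) \is a fin_num.
  by apply: (proper_fin_num g_pcc); rewrite u_rec; exact: (prox_edom g_pcc gx).
have gubar_fin n : g (ubar n) \is a fin_num.
  by apply: (proper_fin_num g_pcc); exact: (prox_edom g_pcc gx).
(* [val c B'] bounds [g] at proximal points that lie within [B'] of [x] and whose
   parameter has inverse at most [c]. *)
pose val c B' := `|fine (g x)| + (norm2 xi + c * (Ba + B')) * B'.
have prox_val n c c' B' : 0 < c -> c^-1 <= c' ->
    norm2 (prox (escale c g) (a n) - x) <= B' ->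
    `|fine (g (prox (escale c g) (a n)))| <= val c' B'.
  move=> c0 cc' uB'; apply: le_trans (prox_value_bound g_pcc gx (a n) c0) _.
  have ci : 0 <= c^-1 by rewrite invr_ge0 ltW.
  rewrite lerD2l ler_pM ?norm2_ge0 ?addr_ge0 ?mulr_ge0 ?norm2_ge0 //.
  rewrite lerD2l ler_pM ?norm2_ge0 //.
  have -> : a n - prox (escale c g) (a n) = (a n - x) - (prox (escale c g) (a n) - x).
    by apply/matrixP => i j; rewrite !mxE; ring.
  by apply: le_trans (norm2B _ _) (lerD (aB n) uB').
have M1_fin : (M1 < +oo)%E.
  apply: (@le_lt_trans _ _ (val (alpha^-1 * k) B +
    val (alpha * lambda)^-1 (Ba + alpha * lambda * norm2 xi))%:E); last by rewrite ltry.
  apply: ge_ereal_sup => _ [n _ <-].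
  rewrite -(fineK (gu_fin n)) -(fineK (gubar_fin n)) -EFinB /= lee_fin.
  apply: le_trans (ler_normB _ _) (lerD _ _); last first.
    exact: (prox_val n _ _ _ al0 (lexx _) (ubarB n)).
  rewrite u_rec; apply: (prox_val n) => //; last by have := uB n.+1; rewrite u_rec.
  by rewrite invfM ler_pM2l ?invr_gt0.
have hs_fin w : edom (conjugate h) w -> conjugate h w \is a fin_num.
  exact: proper_fin_num.
(* [h^*] is bounded below by its subgradient at [y]. *)
have [H hsH] : exists H, forall w, edom (conjugate h) w -> `|fine (conjugate h w)| <= H.
  have [H0 hH0] := compact_fine_bounded_above
    (bounded_closed_compact_cV hs_bounded hs_closed) hs_fin hs_cont.
  have yF := subdiff_edom hs_pcc hs_sub.
  exists (`|H0| + `|fine (conjugate h y)| + norm2 (A *m x) * (`|C0| + norm2 y)) => w wF.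
  have := subgradient_inequality hs_pcc hs_sub wF.
  have := hH0 w wF; have := ler_norm H0.
  have := ler_norm (- fine (conjugate h y)); rewrite normrN.
  have := dotv_cauchy_schwarz (A *m x) (w - y); rewrite ler_norml => /andP[+ _].
  have : norm2 (w - y) <= `|C0| + norm2 y.
    apply: le_trans (norm2B _ _) _; rewrite lerD2r.
    exact: le_trans (domC _ wF) (ler_norm _).
  move=> /(ler_wpM2l (norm2_ge0 (A *m x))).
  have := normr_ge0 H0; have := normr_ge0 (fine (conjugate h y)).
  have := mulr_ge0 (norm2_ge0 (A *m x)) (addr_ge0 (normr_ge0 C0) (norm2_ge0 y)).
  by rewrite ler_norml => *; apply/andP; split; lra.
have M2_fin : (M2 < +oo)%E.
  apply: (@le_lt_trans _ _ (H + H + spectral_norm A *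
    (2 * (B + norm2 x) + (B + norm2 x)) * (C0 + C))%:E); last by rewrite ltry.
  apply: ge_ereal_sup => _ [n _ [w wF <-]].
  rewrite -(fineK (hs_fin _ (v_dom n))) -(fineK (hs_fin _ wF)) -EFinB /= lee_fin.
  have uBx j : norm2 (u j) <= B + norm2 x.
    by apply: le_trans (norm2_dist _ x) _; rewrite lerD2r.
  apply: lerD; first by apply: le_trans (ler_normB _ _) (lerD _ _); exact: hsH.
  rewrite ler_pM ?mulr_ge0 ?norm2_ge0 ?spectral_norm_ge0 //.
    rewrite ler_wpM2l ?spectral_norm_ge0 //.
    apply: le_trans (norm2B _ _) (lerD _ (uBx n)).
    by rewrite norm2Z gtr0_norm // ler_pM2l.
  by apply: le_trans (norm2B _ _) (lerD (domC _ wF) (vC _)).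
split => // n e eps delta; split.
  have M1n : `|fine (g (u n.+1)) - fine (g (ubar n))| <= fine M1.
    have M1ge : (`|g (u n.+1) - g (ubar n)| <= M1)%E.
      by apply: ereal_sup_ubound; exists n.
    have M1f : M1 \is a fin_num.
      by rewrite ge0_fin_numE //; exact: le_trans (abse_ge0 _) M1ge.
    rewrite -lee_fin fineK //; apply: le_trans M1ge.
    by rewrite -(fineK (gu_fin n)) -(fineK (gubar_fin n)).
  rewrite u_rec in M1n *.
  have := prox_rescaled_approx1 g_pcc gx al0 (al_gt0 n) M1n.
  rewrite -mulrBr normrM (gtr0_norm alpha_gt0).
  have -> : alpha * `|lam_ n - lambda| * fine M1 = eps by rewrite /eps; ring.
  have -> // : u n - alpha *: grad f (u n) - (alpha * mu_ n) *: (A^T *m v n) =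
    u n - alpha *: grad f (u n) - (alpha * mu) *: (A^T *m v n) - alpha *: e.
  by apply/matrixP => i j; rewrite /e !mxE; ring.
set p := A *m (2 *: u n.+1 - u n).
have M2n w : edom (conjugate h) w ->
    `|fine (conjugate h (v n.+1)) - fine (conjugate h w)| +
    `|dotv p (w - v n.+1)| <= fine M2.
  move=> wF.
  set t := (`|conjugate h (v n.+1) - conjugate h w| +
          (spectral_norm A * norm2 (2 *: u n.+1 - u n)%R
             * norm2 (w - v n.+1)%R)%:E)%E.
  have M2ge : (t <= M2)%E.
    by apply: ereal_sup_ubound; exists n => //; exists w.
  have tE : t = (`|fine (conjugate h (v n.+1)) - fine (conjugate h w)| +
      spectral_norm A * norm2 (2 *: u n.+1 - u n)%R * norm2 (w - v n.+1)%R)%:E.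
    by rewrite /t -(fineK (hs_fin _ (v_dom n))) -(fineK (hs_fin _ wF)).
  have M2f : M2 \is a fin_num.
    rewrite ge0_fin_numE //; apply: le_trans M2ge; rewrite tE lee_fin.
    by rewrite addr_ge0 ?mulr_ge0 ?norm2_ge0 ?spectral_norm_ge0.
  rewrite -lee_fin fineK //; apply: le_trans M2ge; rewrite tE lee_fin lerD2l.
  apply: le_trans (dotv_cauchy_schwarz _ _) _.
  by rewrite ler_wpM2r ?norm2_ge0 // norm2_mulmx.
rewrite v_rec in M2n *.
have := prox_rescaled_approx2 hs_pcc hs_sub bm0 (bm_gt0 n) M2n.
rewrite -mulrBr normrM (gtr0_norm beta_gt0).
by have -> : beta * `|(mu_ n)^-1 - mu^-1| * fine M2 = delta by rewrite /delta; ring.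
Qed.
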